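(* For every partition $\lambda$, the Sprague–Grundy value of $\lambda$ in \textsc{RIT} equals the Sprague–Grundy value of $\mathrm{rem}(\lambda)$ in \textsc{Nim}: $\mathcal{G}_{\textsc{RIT}}(\lambda)=\mathcal{G}_{\textsc{Nim}}(\mathrm{rem}(\lambda))$.
   Context: An \textsc{RIT} (Row Impartial Terminus) position is a partition $\lambda=(\lambda_1,\dots,\lambda_r)$, written as a nonincreasing tuple of nonnegative integers (a move keeps the length $r$ of the tuple, zero entries being allowed; the empty partition is the unique terminal position). For $k\in[1,\lambda_1]$, there is a move from $\lambda$ to $\bar\lambda$ where $\bar\lambda_i=k-1$ for $i$ the largest index with $\lambda_i\ge k$, and $\bar\lambda_j=\lambda_j$ for $j\ne i$. Informally, a move shortens one row of the Young diagram so that the result is still a Young diagram. Define $\mathrm{rem}(\lambda)$ to be the $\lceil r/2\rceil$-tuple $(\lambda_1-\lambda_2,\lambda_3-\lambda_4,\dots,\lambda_{2\lceil r/2\rceil-1}-\lambda_{2\lceil r/2\rceil})$, where $\lambda_j=0$ for $j>r$ (so $\mathrm{rem}$ of the empty partition is the empty tuple). \textsc{Nim} is played on tuples of nonnegative integers: a move decreases exactly one coordinate by a positive amount. The Sprague–Grundy value of a position $x$ of an impartial game is $\mathcal{G}(x)=\mathrm{mex}\{\mathcal{G}(y): x\to y\}$, where $\mathrm{mex}(S)$ is the least nonnegative integer not in $S$ (so terminal positions have value $0$). *)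

(* Defs.v *)
From HB Require Import structures.
From mathcomp Require Import all_boot.

Set Implicit Arguments.
Unset Strict Implicit.
Unset Printing Implicit Defensive.

Lemma mex_exists (s : seq nat) : exists n, n \notin s.
Proof.
exists (\max_(i <- s) i).+1; apply/negP => in_s.
by have := @leq_bigmax_seq _ s xpredT id _ in_s isT; rewrite ltnn.
Qed.

Definition mex (s : seq nat) : nat := ex_minn (mex_exists s).

Record impartial_game := ImpartialGame {
  position :> eqType;
  options : position -> seq position;
  options_wf : well_founded (fun y x : position => y \in options x)
}.

Definition grundy_step (G : impartial_game) (x : G)
    (rec : forall y : G, y \in options x -> nat) : nat :=
  mex [seq rec (ssval y) (ssvalP y) | y <- seq_sub_enum (options x)].

(* The Sprague-Grundy value; see grundyE for its defining equation. *)
Definition grundy (G : impartial_game) : G -> nat :=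
  Fix (@options_wf G) (fun _ => nat) (@grundy_step G).

Lemma eq_mex (s t : seq nat) : s =i t -> mex s = mex t.
Proof.
by move=> eq_st; apply: eq_ex_minn => n; rewrite eq_st.
Qed.

Lemma grundyE (G : impartial_game) (x : G) :
  grundy x = mex [seq grundy y | y <- options x].
Proof.
rewrite /grundy Fix_eq; last first.
  by move=> y f g eq_fg; congr mex; apply: eq_map => z; apply: eq_fg.
apply: eq_mex => n; apply/mapP/mapP => [[y _ ->]|[y xy ->]].
  by exists (ssval y) => //; apply: ssvalP.
by exists (SeqSub xy); rewrite // mem_seq_sub_enum.
Qed.

Lemma measure_wf (T : eqType) (opts : T -> seq T) (f : T -> nat) :
    (forall x y, y \in opts x -> f y < f x) ->
  well_founded (fun y x => y \in opts x).
Proof.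
move=> dec x; have [n] := ubnP (f x).
elim: n x => [x|n IHn x]; first by rewrite ltn0.
rewrite ltnS => fx; constructor => y /dec fy.
by apply: IHn; apply: leq_trans fx.
Qed.

Lemma sumn_set_nth_lt (s : seq nat) (i m : nat) :
  i < size s -> m < nth 0 s i -> sumn (set_nth 0 s i m) < sumn s.
Proof.
elim: s i => [|x s IHs] [|i] //= lt_i lt_m; first by rewrite ltn_add2r.
by rewrite ltn_add2l IHs.
Qed.

(* A tuple (l_1, ..., l_r) is a sequence indexed from 0, so l_i is
   nth 0 l i.-1; trailing zeros are allowed and count in its length. *)
Record rit_position := RitPosition {
  parts :> seq nat;
  _ : sorted geq parts
}.

HB.instance Definition _ := [isSub for parts].
HB.instance Definition _ := [Equality of rit_position by <:].

Definition last_row (l : seq nat) (k : nat) : nat :=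
  \max_(i < size l | k <= nth 0 l i) i.

Definition rit_move_seq (l : seq nat) (k : nat) : seq nat :=
  set_nth 0 l (last_row l k) k.-1.

Lemma last_row_lt (l : seq nat) (k : nat) : 0 < size l -> last_row l k < size l.
Proof.
case E: (size l) => [|n] // _; rewrite /last_row E ltnS.
by apply/bigmax_leqP => i _; rewrite -ltnS.
Qed.

Lemma last_row_max (l : seq nat) (k i : nat) :
  i < size l -> k <= nth 0 l i -> i <= last_row l k.
Proof.
by move=> lt_i le_k; apply: (leq_bigmax_cond (Ordinal lt_i)).
Qed.

Lemma last_row_ge (l : seq nat) (k : nat) :
  0 < size l -> k <= nth 0 l 0 -> k <= nth 0 l (last_row l k).
Proof.
move=> l_gt0 k_le; rewrite /last_row.
have card_gt0 : 0 < #|[pred i : 'I_(size l) | k <= nth 0 l i]|.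
  by apply/card_gt0P; exists (Ordinal l_gt0); rewrite inE.
by have [j /= jP ->] := eq_bigmax_cond (fun i : 'I_(size l) => i : nat) card_gt0.
Qed.

Lemma rit_move_subproof (l : rit_position) (k : nat) :
  sorted geq (rit_move_seq l k).
Proof.
case: l => l /= l_sorted; rewrite /rit_move_seq.
have [l0|l_gt0] := posnP (size l).
  by rewrite (size0nil l0) /last_row big_ord0.
have r_lt := last_row_lt k l_gt0.
have sz : size (set_nth 0 l (last_row l k) k.-1) = size l.
  by rewrite size_set_nth; apply/maxn_idPr.
apply/(sortedP 0) => i; rewrite sz => i_lt.
have := (sortedP 0 l_sorted) i i_lt; rewrite !nth_set_nth /= /geq /= => le_i.
have [Ei|ni] := eqVneq i (last_row l k).
  rewrite -Ei [i.+1 == i]gtn_eqF //.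
  have: ~~ (k <= nth 0 l i.+1).
    by apply/negP => /(last_row_max i_lt); rewrite -Ei ltnn.
  by case: (k) => //= k'; rewrite -ltnNge ltnS.
have [Ei1|//] := eqVneq i.+1 (last_row l k).
have [k_le|k_gt] := leqP k (nth 0 l 0).
  have := last_row_ge l_gt0 k_le; rewrite -Ei1 => k_le1.
  by apply: leq_trans (leq_pred k) (leq_trans k_le1 le_i).
suff: last_row l k = 0 by rewrite -Ei1.
have geq_trans : transitive geq by move=> a b c ab bc; apply: leq_trans ab.
rewrite /last_row big_pred0 // => j; apply/negbTE; rewrite -ltnNge.
apply: leq_ltn_trans k_gt.
by apply: (sorted_leq_nth geq_trans leqnn 0 l_sorted 0 j); rewrite // inE.
Qed.

(* Only meaningful for 1 <= k <= l_1, which rit_options enforces. *)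
Definition rit_move (l : rit_position) (k : nat) : rit_position :=
  RitPosition (rit_move_subproof l k).

Definition rit_options (l : rit_position) : seq rit_position :=
  [seq rit_move l k | k <- iota 1 (nth 0 l 0)].

Lemma rit_wf : well_founded (fun m l : rit_position => m \in rit_options l).
Proof.
apply: (measure_wf (f := fun l : rit_position => sumn l)) => l m /mapP[k].
rewrite mem_iota add1n ltnS => /andP[k_gt0 k_le] -> /=.
have l_gt0 : 0 < size l.
  by case: (size l =P 0) k_le => [/size0nil->|/eqP]; [case: (k) k_gt0 | case: size].
apply: sumn_set_nth_lt; first exact: last_row_lt.
by have := last_row_ge l_gt0 k_le; case: (k) k_gt0.
Qed.

Definition RIT : impartial_game := ImpartialGame rit_wf.

Definition nim_options (x : seq nat) : seq (seq nat) :=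
  [seq set_nth 0 x i m | i <- iota 0 (size x), m <- iota 0 (nth 0 x i)].

Lemma nim_wf : well_founded (fun y x : seq nat => y \in nim_options x).
Proof.
apply: (measure_wf (f := sumn)) => x y /allpairsPdep[i [m [+ + ->]]].
by rewrite !mem_iota !add0n /= => ? ?; apply: sumn_set_nth_lt.
Qed.

Definition NIM : impartial_game := ImpartialGame nim_wf.

Definition rit_rem (l : seq nat) : seq nat :=
  mkseq (fun i => nth 0 l i.*2 - nth 0 l i.*2.+1) (uphalf (size l)).

(* Main.v *)
Require Import Defs.
From mathcomp Require Import all_boot.
From mathcomp Require Import zify.

(** The map [rit_rem] lifts every Nim move: lowering the [j]-th coordinate of
    [rit_rem l] amounts to shortening row [2j] of [l]. Conversely a RIT move
    changes exactly one coordinate of [rit_rem l], possibly upwards. Two Nim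
    positions differing in exactly one coordinate are joined by a move in one
    direction or the other, so their Grundy values differ. Hence, by induction,
    the Grundy values of the RIT options of [l] contain those of the Nim options
    of [rit_rem l] and omit that of [rit_rem l] itself, so both mex agree. *)

Lemma mex_notin (s : seq nat) : mex s \notin s.
Proof. by rewrite /mex; case: ex_minnP. Qed.

Lemma lt_mex_mem (s : seq nat) (n : nat) : n < mex s -> n \in s.
Proof.
rewrite /mex; case: ex_minnP => m _ min_m lt_nm.
by apply: contraLR lt_nm => /min_m; rewrite -leqNgt.
Qed.

Lemma mex_sub_eq (s t : seq nat) :
  {subset s <= t} -> mex s \notin t -> mex t = mex s.
Proof.
move=> sub_st s_t; case: (ltngtP (mex t) (mex s)) => // [lt_ts|/lt_mex_mem st].
  by have := mex_notin t; rewrite sub_st // lt_mex_mem.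
by rewrite st in s_t.
Qed.

Lemma grundy_option_neq (G : impartial_game) (x y : G) :
  y \in options x -> grundy y != grundy x.
Proof.
move=> xy; rewrite [grundy x]grundyE; apply/eqP => eq_y.
by have /negP[] := mex_notin [seq grundy z | z <- options x]; rewrite -eq_y map_f.
Qed.

(** This isolates the induction on options. [f] need not send options to options: an option of [x]
    may land anywhere in [H] with a Grundy value other than that of [f x]. *)
Lemma grundy_lift (G H : impartial_game) (f : G -> H) :
    (forall (x : G) (z : H), z \in options (f x) ->
       exists2 y, y \in options x & f y = z) ->
    (forall x y : G, y \in options x -> grundy (f y) != grundy (f x)) ->
  forall x : G, grundy x = grundy (f x).
Proof.
move=> lift neq; elim/(well_founded_ind (@options_wf G)) => x IH.
rewrite grundyE [RHS]grundyE; apply: mex_sub_eq => [n /mapP[z xz ->]|].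
  by have [y xy <-] := lift _ _ xz; apply/mapP; exists y; rewrite ?IH.
rewrite -grundyE; apply/mapP => -[y xy]; rewrite IH // => /esym/eqP.
by rewrite (negbTE (neq _ _ xy)).
Qed.

Lemma nim_option_set_nth (x : seq nat) (i m : nat) :
  i < size x -> m < nth 0 x i -> set_nth 0 x i m \in nim_options x.
Proof.
move=> lt_i lt_m; apply/allpairsPdep; exists i, m.
by rewrite !mem_iota !add0n.
Qed.

Lemma set_nth_nth (x : seq nat) (i m : nat) :
  i < size x -> set_nth 0 (set_nth 0 x i m) i (nth 0 x i) = x.
Proof. by elim: x i => [|a x IHx] [|i] //= /IHx->. Qed.

(** If the entry grows, restoring the old one is a Nim move back to [x]. *)
Lemma nim_grundy_set_nth_neq (x : seq nat) (i m : nat) :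
    i < size x -> m != nth 0 x i ->
  @grundy NIM (set_nth 0 x i m) != @grundy NIM x.
Proof.
move=> lt_i; rewrite neq_ltn => /orP[lt_m|gt_m].
  exact: (@grundy_option_neq NIM) (nim_option_set_nth _ _ _ lt_i lt_m).
rewrite eq_sym; apply: (@grundy_option_neq NIM).
rewrite -{1}(set_nth_nth x i m lt_i); apply: nim_option_set_nth.
  by rewrite size_set_nth leq_max ltnSn.
by rewrite nth_set_nth /= eqxx.
Qed.

Lemma nth_rit_rem (l : seq nat) (j : nat) :
  nth 0 (rit_rem l) j = nth 0 l j.*2 - nth 0 l j.*2.+1.
Proof.
have [lt_j|ge_j] := ltnP j (uphalf (size l)); first by rewrite nth_mkseq.
by rewrite !nth_default ?size_mkseq //; lia.
Qed.

(** Row [i] enters only coordinate [i./2], as subtrahend for odd [i] and as minuend for even [i]. *)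
Lemma rit_rem_set_nth (l : seq nat) (i m : nat) : i < size l ->
  rit_rem (set_nth 0 l i m) =
  set_nth 0 (rit_rem l) i./2
    (if odd i then nth 0 l i.-1 - m else m - nth 0 l i.+1).
Proof.
move=> lt_i; apply: (@eq_from_nth _ 0) => [|j _].
  by rewrite size_set_nth !size_mkseq size_set_nth; lia.
rewrite nth_set_nth /= !nth_rit_rem !nth_set_nth /=.
have [->|nj] := eqVneq j i./2; last first.
  by rewrite ifN_eq ?ifN_eq //; lia.
case: (boolP (odd i)) => odd_i.
  have [-> ->] : i./2.*2 = i.-1 /\ i./2.*2.+1 = i by lia.
  by rewrite eqxx ifN_eq //; lia.
have -> : i./2.*2 = i by lia.
by rewrite eqxx ifN_eq //; lia.
Qed.

Lemma parts_nonincreasing (l : rit_position) (i j : nat) :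
  i <= j -> nth 0 l j <= nth 0 l i.
Proof.
case: l => l l_sorted /= le_ij.
have [lt_j|ge_j] := ltnP j (size l); last by rewrite [nth 0 l j]nth_default.
have geq_trans : transitive geq by move=> a b c ab bc; apply: leq_trans ab.
by apply: (sorted_leq_nth geq_trans leqnn 0 l_sorted i j); rewrite ?inE; lia.
Qed.

Lemma last_row_eq (l : rit_position) (k i : nat) :
  nth 0 l i.+1 < k <= nth 0 l i -> last_row l k = i.
Proof.
move=> /andP[lt_k le_k].
have lt_i : i < size l by apply: contraTT le_k => ?; rewrite nth_default; lia.
apply/eqP; rewrite eqn_leq last_row_max // andbT leqNgt.
apply/negP => /(parts_nonincreasing l).
have := @last_row_ge l k; have := parts_nonincreasing l 0 i; lia.
Qed.

Theorem theorem3p3 (lambda : rit_position) :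
  @grundy RIT lambda = @grundy NIM (rit_rem lambda).
Proof.
apply: (@grundy_lift RIT NIM (fun l : rit_position => rit_rem l)).
  move=> l z /allpairsPdep[j [m [+ + ->]]].
  rewrite !mem_iota !add0n /= nth_rit_rem => _ lt_m.
  (* The move leaves [k.-1] in row [j.*2], which exceeds the next row by exactly [m]. *)
  set k := (m + nth 0 l j.*2.+1).+1.
  have row_k : last_row l k = j.*2 by apply: last_row_eq; rewrite /k; lia.
  exists (rit_move l k).
    apply: map_f; rewrite mem_iota.
    by have := parts_nonincreasing l 0 j.*2; rewrite /k; lia.
  have lt_j : j.*2 < size l.
    by apply: contraTT lt_m => ?; rewrite nth_default; lia.
  rewrite /= /rit_move_seq row_k rit_rem_set_nth // odd_double /= doubleK.
  by congr set_nth; rewrite /k /=; lia.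
move=> l y /mapP[k]; rewrite mem_iota add1n ltnS => /andP[k_gt0 k_le] ->.
have l_gt0 : 0 < size l by case: (parts l) k_le => //=; lia.
have lt_i := last_row_lt k l_gt0; have le_k := last_row_ge l_gt0 k_le.
(* By maximality of the last row; past the end the default 0 is below [k]. *)
have gt_k : nth 0 l (last_row l k).+1 < k.
  rewrite ltnNge; apply/negP => le_k1.
  have lt_i1 : (last_row l k).+1 < size l.
    by apply: contraTT le_k1 => ?; rewrite nth_default; lia.
  by have := last_row_max lt_i1 le_k1; rewrite ltnn.
rewrite /= /rit_move_seq rit_rem_set_nth //.
apply: nim_grundy_set_nth_neq; first by rewrite size_mkseq; lia.
rewrite nth_rit_rem; set i := last_row l k in lt_i le_k gt_k *.
(* Row [i] drops to [k.-1]. For odd [i] the coordinate strictly grows, as row [i.-1] is at least row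
   [i]. For even [i] it strictly drops: [gt_k] keeps [k.-1] at or above row [i.+1], so the
   subtraction does not truncate. *)
case: ifPn => odd_i.
  have [-> ->] : i./2.*2 = i.-1 /\ i./2.*2.+1 = i by lia.
  by have := parts_nonincreasing l i.-1 i; lia.
have -> : i./2.*2 = i by lia.
lia.
Qed.
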